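(* Let $G$ be a finite group and $A$ a finite set of size $q\geq 2$. Let \[ R := \left\{ \sigma \in \mathrm{CA}(G;A) : G_x = G_{(x)\sigma} \text{ for all } x \in A^G \right\}. \] Then: (i) $R = \left\{ \sigma \in \mathrm{CA}(G;A) : (B_{[H]})\sigma \subseteq B_{[H]} \text{ for all } H \leq G \right\}$. (ii) $\mathrm{ICA}(G;A) \leq R$. (iii) $R$ is a vN-regular monoid. (iv) $R$ is not a maximal vN-regular submonoid of $\mathrm{CA}(G;A)$.
   Context: Functions are applied on the right, and composition is read left to right: $\tau\sigma$ means first $\tau$, then $\sigma$. For a group $G$ and a set $A$, $A^G$ is the set of all functions $x: G\to A$; $G$ acts on $A^G$ by $(h)(x\cdot g) := (hg^{-1})x$ for $g,h\in G$, $x\in A^G$. A cellular automaton over $A^G$ is a map $\tau : A^G \to A^G$ for which there exist a finite subset $S \subseteq G$ (a memory set) and a function $\mu : A^S \to A$ (a local function) such that $(g)(x)\tau = ((x\cdot g^{-1})|_S)\mu$ for all $x\in A^G$, $g\in G$. $\mathrm{CA}(G;A)$ is the monoid of all cellular automata over $A^G$ under composition, and $\mathrm{ICA}(G;A)$ is its group of units (those $\tau\in\mathrm{CA}(G;A)$ for which there is $\sigma \in \mathrm{CA}(G;A)$ with $\tau\sigma=\sigma\tau=\mathrm{id}$). For a group, respectively a monoid, $M$, $K\leq M$ means that $K$ is a subgroup, respectively a submonoid, of $M$. The stabiliser of $x \in A^G$ is $G_x := \{g\in G : x\cdot g = x\}$. For a subgroup $H\leq G$, $[H]$ denotes its conjugacy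 class in $G$, and the box in $A^G$ corresponding to $[H]$ is $B_{[H]} := \{x\in A^G : [G_x]=[H]\}$. An element $a$ of a monoid $M$ is vN-regular (von Neumann regular) if there exists $b\in M$ with $aba=a$; a monoid is vN-regular if all of its elements are vN-regular (in that monoid). A submonoid $R \leq M$ is called maximal vN-regular if there is no vN-regular monoid $K$ such that $R < K < M$, where $<$ means proper submonoid.
   Formalization: Part (iv) is stated only for nontrivial G: if G is trivial, all stabilisers equal G, so R = CA(G;A) and no monoid K satisfies R < K < CA(G;A), making R maximal by the given definition; parts (i)–(iii) are for all finite G. *)

(* Defs.v *)
From HB Require Import structures.
From mathcomp Require Import all_boot all_fingroup.

Set Implicit Arguments.
Unset Strict Implicit.
Unset Printing Implicit Defensive.

Local Open Scope group_scope.

Section Monoids.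

Variable M : monoidType.
Implicit Types K N R : {pred M}.

Definition submonoid K N := monoid_closed K /\ {subset K <= N}.

Definition proper_submonoid K N :=
  submonoid K N /\ exists2 a, a \in N & a \notin K.

Definition vN_regular K :=
  {in K, forall a, exists2 b, b \in K & a * b * a = a}.

(* R = N is not excluded: N is maximal in N, since no K satisfies N < K < N.  *)
Definition maximal_vN_regular R N :=
  ~ exists K : {pred M},
      [/\ vN_regular K, proper_submonoid R K & proper_submonoid K N].

End Monoids.

(* An alias of {ffun X -> X} carrying the composition monoid; functions act on *)
(* the right, so the product s * t is "first s, then t".                       *)
Definition transf (X : finType) := {ffun X -> X}.

HB.instance Definition _ (X : finType) := Finite.on (transf X).

Section TransfMonoid.

Variable X : finType.
Implicit Types s t u : transf X.

Definition transf_mul s t : transf X := [ffun x => t (s x)].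
Definition transf_one : transf X := [ffun x => x].

Lemma transf_mulA : associative transf_mul.
Proof. by move=> s t u; apply/ffunP=> x; rewrite !ffunE. Qed.

Lemma transf_mul1 : left_id transf_one transf_mul.
Proof. by move=> s; apply/ffunP=> x; rewrite !ffunE. Qed.

Lemma transf_1mul : right_id transf_one transf_mul.
Proof. by move=> s; apply/ffunP=> x; rewrite !ffunE. Qed.

HB.instance Definition _ := isMonoid.Build (transf X)
  transf_mulA transf_mul1 transf_1mul.

End TransfMonoid.

Notation config gT A := {ffun gT -> A} (only parsing).
Notation patterns A S := {ffun {s | s \in S} -> A} (only parsing).

Section CellularAutomata.

Variables (gT : finGroupType) (A : finType).

Local Notation config := (config gT A).
Local Notation patterns S := (patterns A S).

Implicit Types (x : config) (tau sigma : transf config) (S : {set gT}).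

Definition shift_fun x (g : gT) : config := [ffun h => x (h * g^-1)].

Lemma shift_fun1 : shift_fun^~ 1 =1 id.
Proof. by move=> x; apply/ffunP=> h; rewrite !ffunE invg1 mulg1. Qed.

Lemma shift_funM x : act_morph shift_fun x.
Proof. by move=> g k; apply/ffunP=> h; rewrite !ffunE invMg mulgA. Qed.

Definition shift : {action gT &-> config} := TotalAction shift_fun1 shift_funM.

Definition restriction S x : patterns S := [ffun s => x (val s)].

Definition has_local_rule tau S (mu : {ffun patterns S -> A}) :=
  [forall x : config, forall g : gT,
     tau x g == mu (restriction S (shift x g^-1))].

Definition CA : {set transf config} :=
  [set tau | [exists S : {set gT},
               exists mu : {ffun patterns S -> A}, has_local_rule tau mu]].

Definition ICA : {set transf config} :=
  [set tau in CA | [exists sigma in CA,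
                     (tau * sigma == 1) && (sigma * tau == 1)]].

(* H :^: [set: gT] is the set of all conjugates of H in the whole group. *)
Definition box (H : {group gT}) : {set config} :=
  [set x | 'C[x | shift] :^: [set: gT] == H :^: [set: gT]].

End CellularAutomata.

(* Main.v *)
(** Over a finite group every finite memory set may be enlarged to the whole
    group, so cellular automata are exactly the shift-equivariant maps. Such a
    map can only enlarge stabilisers, and G_x = G_(x)sigma as soon as the two
    are conjugate, by cardinality; this gives (i), and (ii) follows by applying
    the inverse automaton. For (iii), a quasi-inverse of sigma sends a point y
    of the image to a preimage of y and fixes all other points; the preimage can
    be chosen equivariantly because it has the same stabiliser as y. For (iv),
    adjoin to R the constant maps whose value is a shift-invariant
    configuration. They are idempotent, and multiplying one of them by an
    element of R gives another one. If G is nontrivial they are not in R, and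
    the automaton that fixes the invariant configurations and sends all others
    to a single invariant one is still missing. *)
Require Import Defs.
From mathcomp Require Import all_boot all_fingroup.

Set Implicit Arguments.
Unset Strict Implicit.
Unset Printing Implicit Defensive.

Local Open Scope group_scope.

Section Equivariant.

Variables (gT : finGroupType) (T : finType) (to : {action gT &-> T}).

Definition equivariant (f : T -> T) := forall x g, f (to x g) = to (f x) g.

Lemma equivariant_astab1 f x :
  equivariant f -> 'C[x | to] \subset 'C[f x | to].
Proof.
move=> ef; apply/subsetP=> g /astab1P xg.
by apply/astab1P; rewrite -ef xg.
Qed.

Lemma equivariant_astab1_conj f x :
    equivariant f ->
    'C[f x | to] :^: [set: gT] = 'C[x | to] :^: [set: gT] ->
  'C[x | to] = 'C[f x | to].
Proof.
move=> ef Ecl; apply/eqP; rewrite eqEcard equivariant_astab1 //=.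
have : 'C[f x | to] :^ 1 \in 'C[x | to] :^: [set: gT].
  by rewrite -Ecl; apply: imset_f; rewrite inE.
by rewrite conjsg1 => /imsetP[g _ ->]; rewrite cardJg.
Qed.

(* Choose images of orbit representatives and propagate them along orbits; the *)
(* inclusion of stabilisers makes the result well defined.                     *)
Lemma equivariant_choice (P : rel T) :
    (forall y x g, P y x -> P (to y g) (to x g)) ->
    (forall y x, P y x -> 'C[y | to] \subset 'C[x | to]) ->
    (forall y, exists x, P y x) ->
  exists2 f, equivariant f & forall y, P y (f y).
Proof.
move=> PJ PC exP.
pose F y := xchoose (exP y).
have PF y : P y (F y) by apply: xchooseP.
(* The pick depends only on the orbit as a set, so all points of an orbit share one representative.
   The default [y] is never returned, since the orbit contains [y]. *)
pose r y := odflt y [pick z in orbit to [set: gT] y].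
have r_orbit y : r y \in orbit to [set: gT] y.
  by rewrite /r; case: pickP => //= _; apply: orbit_refl.
have rJ y g : r (to y g) = r y.
  rewrite /r.
  have -> : orbit to [set: gT] (to y g) = orbit to [set: gT] y.
    by apply: orbit_act; rewrite inE.
  by case: pickP => //= /(_ y); rewrite orbit_refl.
have exh y : exists g, to (r y) g == y.
  have := r_orbit y; rewrite orbit_sym => /orbitP[g _ Eg].
  by exists g; apply/eqP.
pose h y := xchoose (exh y).
have rh y : to (r y) (h y) = y by apply/eqP/(xchooseP (exh y)).
exists (fun y => to (F (r y)) (h y)) => [y g|y]; last by rewrite -{1}(rh y) PJ.
(* Both [h (to y g)] and [h y * g] carry [r y] to [to y g]. They differ by a stabiliser of [r y],
   which by [PC] also fixes [F (r y)]. *)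
have : h (to y g) * (h y * g)^-1 \in 'C[r y | to].
  apply/astab1P; rewrite actM -{1}(rJ y g) rh.
  by rewrite -{1}(rh y) -!actM mulgA mulgV act1.
move/(subsetP (PC _ _ (PF _)))/astab1P => E.
by rewrite rJ -actM -{2}E -actM mulgKV.
Qed.

End Equivariant.

Section CellularAutomata.

Variables (gT : finGroupType) (A : finType).
Local Notation shift := (shift gT A).
Local Notation CA := (CA gT A).
Implicit Types (x y : config gT A) (sigma tau : transf (config gT A)).

(** * Cellular automata as shift-equivariant maps *)

Lemma transf_mulE (X : finType) (s t : transf X) (x : X) : (s * t) x = t (s x).
Proof. by rewrite [LHS]ffunE. Qed.

Lemma transf_oneE (X : finType) (x : X) : (1 : transf X) x = x.
Proof. by rewrite [LHS]ffunE. Qed.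

Lemma shiftE x g h : shift x g h = x (h * g^-1).
Proof. by rewrite [LHS]ffunE. Qed.

Lemma CAP sigma : reflect (equivariant shift sigma) (sigma \in CA).
Proof.
apply: (iffP idP) => [|es].
  rewrite inE => /existsP[S /existsP[mu /forallP rule]] x g.
  apply/ffunP=> h; rewrite shiftE.
  rewrite (eqP (forallP (rule _) h)) (eqP (forallP (rule x) _)).
  by rewrite -actM invMg invgK.
rewrite inE; apply/existsP; exists setT.
pose ext (p : patterns A [set: gT]) : config gT A :=
  [ffun g => p (Sub g (in_setT g))].
(* By equivariance [sigma] is determined by its values at 1, so these serve as the local
   function. *)
apply/existsP; exists [ffun p => sigma (ext p) 1].
apply/forallP=> x; apply/forallP=> g; rewrite ffunE.
have -> : ext (restriction setT (shift x g^-1)) = shift x g^-1.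
  by apply/ffunP=> h; rewrite !ffunE.
by rewrite es shiftE invgK mul1g.
Qed.

Lemma CA1 : 1 \in CA.
Proof. by apply/CAP=> x g; rewrite !transf_oneE. Qed.

Lemma CAM sigma tau : sigma \in CA -> tau \in CA -> sigma * tau \in CA.
Proof.
by move=> /CAP es /CAP et; apply/CAP=> x g; rewrite !transf_mulE es et.
Qed.

Lemma ICAP sigma :
  reflect (sigma \in CA
             /\ exists2 tau, tau \in CA & sigma * tau = 1 /\ tau * sigma = 1)
          (sigma \in ICA gT A).
Proof.
rewrite [sigma \in ICA gT A]in_set; apply: (iffP andP) => -[Cs].
  by case/existsP=> t /and3P[Ct /eqP st /eqP ts]; split=> //; exists t.
case=> t Ct [st ts]; split=> //; apply/existsP; exists t.
by rewrite Ct st ts eqxx.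
Qed.

Lemma ICA_closed : monoid_closed (ICA gT A).
Proof.
split=> [|s t /ICAP[Cs [s' Cs' [ss' s's]]] /ICAP[Ct [t' Ct' [tt' t't]]]].
  by apply/ICAP; split; [apply: CA1 | exists 1; rewrite ?CA1 ?mulg1].
apply/ICAP; split; first exact: CAM.
exists (t' * s'); first exact: CAM.
split; first by rewrite mulgA -(mulgA s) tt' mulg1.
by rewrite mulgA -(mulgA t') s's mulg1.
Qed.

(** * Automata that preserve stabilisers *)

Definition stab_preserving : {set transf (config gT A)} :=
  [set sigma in CA | [forall x, 'C[x | shift] == 'C[sigma x | shift]]].

Lemma stab_preservingP sigma :
  reflect (equivariant shift sigma
             /\ forall x, 'C[x | shift] = 'C[sigma x | shift])
          (sigma \in stab_preserving).
Proof.
rewrite inE; apply: (iffP andP) => [[/CAP es /forallP st]|[es st]].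
  by split=> // x; apply/eqP.
by split; [apply/CAP | apply/forallP=> x; apply/eqP].
Qed.

Lemma stab_preserving_box :
  stab_preserving =
    [set sigma in CA |
      [forall H : {group gT}, [set sigma x | x in box A H] \subset box A H]].
Proof.
apply/setP=> sigma; rewrite [in RHS]inE.
apply/stab_preservingP/andP => [[es st]|[/CAP es /forallP boxed]].
  split; first exact/CAP.
  apply/forallP=> H; apply/subsetP=> _ /imsetP[x xH ->].
  by move: xH; rewrite !inE st.
split=> // x; apply: equivariant_astab1_conj => //.
(* The box of the stabiliser of [x] contains [x], hence also [sigma x]. *)
have /subsetP/(_ (sigma x)) := boxed 'C[x | shift]%G.
rewrite inE => boxed_x; apply/eqP/boxed_x/imset_f.
by rewrite inE.
Qed.

Lemma stab_preserving_closed : monoid_closed stab_preserving.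
Proof.
split=> [|s t /stab_preservingP[es ss] /stab_preservingP[et st]].
  apply/stab_preservingP; split=> [|x]; last by rewrite transf_oneE.
  exact/CAP/CA1.
apply/stab_preservingP; split; first by apply/CAP/CAM; apply/CAP.
by move=> x; rewrite transf_mulE ss st.
Qed.

Lemma stab_preserving_CA : {subset stab_preserving <= CA}.
Proof. by move=> s /stab_preservingP[/CAP]. Qed.

Lemma ICA_stab_preserving : {subset ICA gT A <= stab_preserving}.
Proof.
move=> s /ICAP[/CAP es [t /CAP et [st _]]].
apply/stab_preservingP; split=> // x; apply/eqP.
rewrite eqEsubset equivariant_astab1 //=.
by have := equivariant_astab1 (s x) et; rewrite -transf_mulE st transf_oneE.
Qed.

Lemma stab_preserving_vN_regular : vN_regular stab_preserving.
Proof.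
move=> s /stab_preservingP[es ss].
pose P y x := (s x == y) || (y \notin codom s) && (x == y).
have codomJ y g : (shift y g \in codom s) = (y \in codom s).
  apply/codomP/codomP=> [[x Ex]|[x ->]]; last by exists (shift x g).
  by exists (shift x g^-1); rewrite es -Ex actK.
have stabP y x : P y x -> 'C[y | shift] = 'C[x | shift].
  by case/orP=> [/eqP <-|/andP[_ /eqP ->]].
have [|y x /stabP->//|y|f ef Pf] := @equivariant_choice _ _ shift P.
- move=> y x g /orP[/eqP <-|/andP[sy /eqP ->]]; first by rewrite /P es eqxx.
  by rewrite /P codomJ sy eqxx orbT.
- have [/codomP[x ->]|sy] := boolP (y \in codom s).
    by exists x; rewrite /P eqxx.
  by exists y; rewrite /P sy eqxx orbT.
exists [ffun y => f y].
  apply/stab_preservingP; split=> [y g|y]; first by rewrite !ffunE.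
  by rewrite ffunE; apply: stabP.
apply/ffunP=> x; rewrite !transf_mulE ffunE.
(* As [s x] lies in the image, only the first alternative of [P] is possible, and it reads
   [s (f (s x)) = s x]. *)
by have /orP[/eqP //|] := Pf (s x); rewrite codom_f.
Qed.

(** * Shift-invariant configurations and constant maps *)

Definition cst_config (a : A) : config gT A := [ffun=> a].

Lemma shift_cst a g : shift (cst_config a) g = cst_config a.
Proof. by apply/ffunP=> h; rewrite shiftE !ffunE. Qed.

(** Shifting [x] by [h] brings its value at 1 to position [h]. *)
Lemma fixed_cst x : 'C[x | shift] = setT -> x = cst_config (x 1).
Proof.
move=> Cx; apply/ffunP=> h; rewrite ffunE.
have /astab1P Ex : h \in 'C[x | shift] by rewrite Cx inE.
by rewrite -{1}Ex shiftE mulgV.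
Qed.

Lemma astab1_cst a : 'C[cst_config a | shift] = setT.
Proof. by apply/setP=> g; rewrite in_setT; apply/astab1P/shift_cst. Qed.

Definition cst_map (a : A) : transf (config gT A) := [ffun=> cst_config a].

Lemma cst_map_CA a : cst_map a \in CA.
Proof. by apply/CAP=> x g; rewrite !ffunE shift_cst. Qed.

Lemma cst_mulr s a : s * cst_map a = cst_map a.
Proof. by apply/ffunP=> x; rewrite transf_mulE !ffunE. Qed.

(** A stabiliser-preserving map sends invariant configurations to invariant ones, and these are
    constant. *)
Lemma cst_mull s a :
  s \in stab_preserving -> cst_map a * s = cst_map (s (cst_config a) 1).
Proof.
move=> /stab_preservingP[_ ss]; apply/ffunP=> x.
by rewrite transf_mulE !ffunE; apply: fixed_cst; rewrite -ss astab1_cst.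
Qed.

Definition stab_preserving_cst := stab_preserving :|: [set s in codom cst_map].

Lemma stab_preserving_cst_closed : monoid_closed stab_preserving_cst.
Proof.
have [R1 RM] := stab_preserving_closed.
split=> [|s t]; first by rewrite inE R1.
move=> sK /setUP[Rt|]; last first.
  by rewrite inE => /codomP[a ->]; rewrite cst_mulr !inE codom_f orbT.
case/setUP: sK => [Rs|]; first by apply/setUP; left; apply: RM.
by rewrite inE => /codomP[a ->]; rewrite cst_mull // !inE codom_f orbT.
Qed.

Lemma stab_preserving_cst_vN_regular : vN_regular stab_preserving_cst.
Proof.
move=> s /setUP[/stab_preserving_vN_regular[t Rt E]|sc].
  by exists t => //; apply/setUP; left.
exists s; first by apply/setUP; right.
by move: sc; rewrite inE => /codomP[a ->]; rewrite !cst_mulr.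
Qed.

Definition collapse (a : A) : transf (config gT A) :=
  [ffun x => if 'C[x | shift] == setT then x else cst_config a].

Lemma collapse_CA a : collapse a \in CA.
Proof.
apply/CAP=> x g; rewrite !ffunE.
(* The stabiliser of a shifted configuration is a conjugate of the original one, so it has the same
   cardinality. *)
have -> : ('C[shift x g | shift] == setT) = ('C[x | shift] == setT).
  have -> : 'C[shift x g | shift] = 'C[x | shift] :^ g.
    by rewrite astab1_act // inE.
  by rewrite !eqEcard !subsetT cardJg.
by case: ifP => // _; rewrite shift_cst.
Qed.

End CellularAutomata.

Theorem theorem5 (gT : finGroupType) (A : finType) (hA : 2 <= #|A|) :
  let R : {set transf (config gT A)} :=
    [set sigma in CA gT A |
      [forall x : config gT A,
         'C[x | shift gT A]%g == 'C[sigma x | shift gT A]%g]] in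
  [/\ R = [set sigma in CA gT A |
            [forall H : {group gT},
               [set sigma x | x in box A H] \subset box A H]],
      submonoid (ICA gT A) R,
      submonoid R (CA gT A) /\ vN_regular R &
      1 < #|[set: gT]| -> ~ maximal_vN_regular R (CA gT A)].
Proof.
move=> R; rewrite -/(stab_preserving gT A) in R *.
split; first exact: stab_preserving_box.
- by split; [apply: ICA_closed | apply: ICA_stab_preserving].
- split; last exact: stab_preserving_vN_regular.
  by split; [apply: stab_preserving_closed | apply: stab_preserving_CA].
move=> gT_gt1; apply.
have [a [b [_ _ neq_ab]]] := card_gt1P hA.
have /trivgPn[g _ g_neq1] : [set: gT] != 1 by rewrite -cardG_gt1.
(* Since [g] is not 1, [x] takes both values [a] and [b], so its stabiliser is proper. Any map
   sending it to a constant enlarges that stabiliser. *)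
pose x : config gT A := [ffun h => if h == 1 then a else b].
have Cx : 'C[x | shift gT A] != setT.
  apply/eqP=> /fixed_cst/ffunP/(_ g)/eqP.
  by rewrite !ffunE eqxx (negPf g_neq1) eq_sym (negPf neq_ab).
have not_R (s : transf (config gT A)) c :
    s x = cst_config gT c -> s \notin stab_preserving gT A.
  move=> sx; apply/stab_preservingP=> -[_ /(_ x)].
  by rewrite sx astab1_cst; apply/eqP.
exists (stab_preserving_cst gT A : {pred transf (config gT A)}); split.
- exact: stab_preserving_cst_vN_regular.
- split; first split; first exact: stab_preserving_closed.
    by move=> s Rs; apply/setUP; left.
  exists (cst_map gT a); first by rewrite !inE codom_f orbT.
  by apply: (not_R _ a); rewrite ffunE.
split; first split; first exact: stab_preserving_cst_closed.
  move=> s /setUP[/stab_preserving_CA //|].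
  by rewrite inE => /codomP[c ->]; apply: cst_map_CA.
exists (collapse gT a); first exact: collapse_CA.
apply/setUP=> -[|]; first by apply/negP/(not_R _ a); rewrite ffunE (negPf Cx).
(* [collapse] fixes the constant configurations of [a] and [b], which differ, so it is not a
   constant map. *)
rewrite inE => /codomP[c /ffunP E].
have := E (cst_config gT a); have := E (cst_config gT b).
rewrite !ffunE !astab1_cst eqxx => <- /ffunP/(_ 1)/eqP.
by rewrite !ffunE (negPf neq_ab).
Qed.
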